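(* Let $r>0$ and $h>0$, consider the difference equation $y_{n+1}=y_n e^{r-y_{n-1}}+h$, and let $r_1=h+1-\ln(h+1)$. Then: (i) The equation has a unique non-negative equilibrium solution $\bar y_h$, and $\bar y_h>\max\{r,h\}$. (ii) If $0<r<r_1$, then $\bar y_h$ is locally asymptotically stable, while if $r>r_1$, then $\bar y_h$ is unstable.
   Context: An equilibrium is a number $\bar y$ with $\bar y=\bar y e^{r-\bar y}+h$. Stability of $\bar y_h$ means stability of the fixed point $(\bar y_h,\bar y_h)$ of the planar map $T(x,y)=(xe^{r-y}+h,\,x)$ on $\mathbb{R}_+^2$, where $\mathbb{R}_+=[0,\infty)$. *)

(* Defs.v *)
From HB Require Import structures.
From mathcomp Require Import all_boot all_order all_algebra.
From mathcomp Require Import all_classical all_reals all_analysis.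

Set Implicit Arguments.
Unset Strict Implicit.
Unset Printing Implicit Defensive.
Import Order.TTheory GRing.Theory Num.Theory.
Import numFieldNormedType.Exports.
Local Open Scope classical_set_scope.
Local Open Scope ring_scope.

(* Lyapunov stability of a fixed point p of T, regarded as a map on D: only
   initial points in D are considered, D being assumed invariant under T. *)
Definition stable (R : realType) (V : pseudoMetricNormedZmodType R)
    (D : set V) (T : V -> V) (p : V) : Prop :=
  forall e : R, 0 < e -> exists2 d : R, 0 < d &
    forall z : V, D z -> `|z - p| < d -> forall n : nat, `|iter n T z - p| < e.

Definition locally_asymptotically_stable (R : realType)
    (V : pseudoMetricNormedZmodType R) (D : set V) (T : V -> V) (p : V) : Prop :=
  stable D T p /\
  exists2 d : R, 0 < d &
    forall z : V, D z -> `|z - p| < d -> iter n T z @[n --> \oo] --> p.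

Definition unstable (R : realType) (V : pseudoMetricNormedZmodType R)
    (D : set V) (T : V -> V) (p : V) : Prop :=
  ~ stable D T p.

(* An equilibrium of y_(n+1) = y_n * exp (r - y_(n-1)) + h. *)
Definition equilibrium (R : realType) (r h y : R) : Prop :=
  y = y * expR (r - y) + h.

(* The map sending (y_n, y_(n-1)) to (y_(n+1), y_n). The norm on R * R is the
   sup norm; stability notions do not depend on the choice of norm. *)
Definition planar_map (R : realType) (r h : R) (z : R * R) : R * R :=
  (z.1 * expR (r - z.2) + h, z.1).

Definition nonneg_quadrant (R : realType) : set (R * R) :=
  [set z | 0 <= z.1 /\ 0 <= z.2].

Definition r1 (R : realType) (h : R) : R := h + 1 - ln (h + 1).

(* Main.v *)
Require Import Defs.
From mathcomp Require Import all_boot all_order all_algebra.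
From mathcomp Require Import all_classical all_reals all_analysis.
From mathcomp Require Import ring lra.
Import Order.TTheory GRing.Theory Num.Theory.
Import numFieldNormedType.Exports.
Local Open Scope classical_set_scope.
Local Open Scope ring_scope.

(** The gain [y * (1 - expR (r - y))] increases strictly on [[r, +oo[], so it
    takes the value [h] exactly once, and comparing it with [h] at [h + 1]
    shows that [b = ybar - h] lies below or above [1] according to the sign of
    [r1 h - r].  In the coordinates [u = x - ybar], [v = y - ybar] the
    linearization is [(u, v) |-> (a * u - b * v, u)] with
    [a = expR (r - ybar) < 1].  If [b < 1], a positive definite quadratic form
    decreases along it; if [1 < b], the form [u ^+ 2 - a * u * v + b * v ^+ 2]
    is positive definite and is multiplied by exactly [b].  The
    nonlinear terms change these forms only to third order in [|(u, v)|], so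
    both facts persist near the equilibrium. *)

(** * Quadratic Lyapunov criteria for stability and instability *)

Lemma lyapunov_asymptotically_stable {R : realType}
    (V : pseudoMetricNormedZmodType R) (D : set V) (T : V -> V) (p : V)
    (Q : V -> R) (m M rho eta : R) :
    0 < m -> 0 < M -> 0 <= rho < 1 -> 0 < eta ->
    (forall z, m * `|z - p| ^+ 2 <= Q z <= M * `|z - p| ^+ 2) ->
    (forall z, D z -> D (T z)) ->
    (forall z, D z -> `|z - p| < eta -> Q (T z) <= rho * Q z) ->
  locally_asymptotically_stable D T p.
Proof.
move=> m0 M0 /andP[rho0 rho1] eta0 mQM DT QT.
have basin e : 0 < e -> e <= eta -> exists2 d, 0 < d &
    forall z, D z -> `|z - p| < d -> forall n,
      [/\ D (iter n T z), `|iter n T z - p| < e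
        & Q (iter n T z) <= rho ^+ n * Q z].
  move=> e0 ele; have mM0 : 0 < m + M by rewrite addr_gt0.
  (* This radius [d] gives [M * d ^+ 2 < m * e ^+ 2] without square roots, because
     [m * M < (m + M) ^+ 2]. The sublevel set [Q < m * e ^+ 2] then traps the orbit in the
     [e]-ball. *)
  exists (e * (m / (m + M))); first by rewrite mulr_gt0// divr_gt0.
  set d := e * _ => z Dz zd.
  have Qz : Q z < m * e ^+ 2.
    have [_ /le_lt_trans->//] := andP (mQM z).
    apply: (@le_lt_trans _ _ (M * d ^+ 2)).
      by rewrite ler_pM2l// lerXn2r ?nnegrE// ltW// (le_lt_trans _ zd).
    rewrite /d exprMn mulrCA [ltRHS]mulrC ltr_pM2l ?exprn_gt0//.
    rewrite expr_div_n mulrA ltr_pdivrMr ?exprn_gt0//.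
    rewrite [m ^+ 2]expr2 mulrCA ltr_pM2l//.
    by have := mulr_gt0 m0 M0; have := sqr_ge0 m; have := exprn_gt0 2 M0; lra.
  have Q0 x : 0 <= Q x.
    by have [/(le_trans _)-> //] := andP (mQM x); rewrite mulr_ge0// ltW.
  have small x : Q x < m * e ^+ 2 -> `|x - p| < e.
    move=> Qx; have [/le_lt_trans/(_ Qx)] := andP (mQM x).
    by rewrite ltr_pM2l// ltr_pXn2r// nnegrE// ltW.
  elim=> [|n [Dn nd Qn]].
    by split => //; [exact: small | rewrite mul1r].
  have Qn1 : Q (iter n.+1 T z) <= rho ^+ n.+1 * Q z.
    rewrite exprS -mulrA (le_trans (QT _ Dn _)) ?(lt_le_trans nd)//.
    by rewrite ler_wpM2l.
  split => //; first exact: DT.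
  apply/small/(le_lt_trans Qn1)/(le_lt_trans _ Qz).
  by rewrite ler_piMl// exprn_ile1// ltW.
split.
  move=> e e0; have me0 : 0 < Num.min e eta by rewrite lt_min e0.
  have [|d d0 dP] := basin _ me0; first by rewrite ge_min lexx orbT.
  exists d => // z Dz /(dP z Dz) zP n; have [_ + _] := zP n.
  by rewrite lt_min => /andP[].
have [//|d d0 dP] := basin _ eta0.
exists d => // z Dz /(dP z Dz) zP.
have rho_cvg : geometric (Q z) rho n @[n --> \oo] --> 0.
  by apply: cvg_geometric; rewrite ger0_norm.
apply/cvgrPdist_lt => e e0; near=> n.
rewrite distrC -(@ltr_pXn2r _ 2)// ?nnegrE// ?ltW// -(ltr_pM2l m0).
have [/le_lt_trans + _] := andP (mQM (iter n T z)); apply.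
have [_ _ /le_lt_trans] := zP n; apply.
rewrite mulrC (le_lt_trans (ler_norm _))//.
near: n; apply: (cvgr0_norm_lt _ rho_cvg).
by rewrite mulr_gt0// exprn_gt0.
Unshelve. all: by end_near. Qed.

(** An orbit confined to the [eta]-ball would have [Q] bounded by [M * eta ^+ 2], while a positive
    initial value grows at least like [rho ^+ n]. *)
Lemma expanding_unstable {R : realType}
    (V : pseudoMetricNormedZmodType R) (D : set V) (T : V -> V) (p : V)
    (Q : V -> R) (M rho eta : R) :
    0 < M -> 1 < rho -> 0 < eta ->
    (forall z, Q z <= M * `|z - p| ^+ 2) ->
    (forall z, D z -> D (T z)) ->
    (forall z, D z -> `|z - p| < eta -> rho * Q z <= Q (T z)) ->
    (forall d, 0 < d -> exists z, [/\ D z, `|z - p| < d & 0 < Q z]) ->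
  unstable D T p.
Proof.
move=> M0 rho1 eta0 QM DT QT Qpos /(_ _ eta0)[d d0 st].
have [z [Dz zd Qz]] := Qpos _ d0.
have rho0 : 0 < rho by rewrite (lt_trans _ rho1).
have Dn n : D (iter n T z) by elim: n => // n; exact: DT.
have Qn n : rho ^+ n * Q z <= Q (iter n T z).
  elim: n => [|n IH]; first by rewrite mul1r.
  rewrite exprS -mulrA (le_trans _ (QT _ (Dn n) (st _ Dz zd n)))//.
  by rewrite ler_wpM2l// ltW.
have rho_cvg : geometric (M * eta ^+ 2) rho^-1 n @[n --> \oo] --> 0.
  by apply: cvg_geometric; rewrite gtr0_norm ?invr_gt0// invf_lt1.
have [n _ /(_ n (leqnn n))] := cvgr0_norm_lt _ rho_cvg _ Qz.
rewrite /= ltNge => /negP; apply; apply: le_trans (ler_norm _).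
rewrite exprVn ler_pdivlMr ?exprn_gt0// mulrC (le_trans (Qn n))//.
rewrite (le_trans (QM _))// ler_pM2l//; have := ltW (st _ Dz zd n).
by apply: lerXn2r; rewrite nnegrE ?normr_ge0 ?ltW.
Qed.

(** * Binary quadratic forms under the linear and nonlinear steps *)

Definition quad {R : realType} (B C u v : R) : R :=
  u ^+ 2 - B * u * v + C * v ^+ 2.

Lemma quad_le {R : realType} (B C u v s : R) :
  `|u| <= s -> `|v| <= s -> 0 <= C -> quad B C u v <= (1 + `|B| + C) * s ^+ 2.
Proof.
move=> us vs C0; have s0 := le_trans (normr_ge0 u) us.
have sq x : `|x| <= s -> x ^+ 2 <= s ^+ 2.
  by move=> xs; rewrite -real_normK ?num_real// lerXn2r ?nnegrE.
have Buv : - (B * u * v) <= `|B| * s ^+ 2.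
  rewrite (le_trans (ler_norm _))// normrN !normrM -mulrA ler_wpM2l// expr2.
  by rewrite ler_pM.
have := ler_wpM2l C0 (sq _ vs); have := sq _ us; rewrite /quad; lra.
Qed.

(** Completing the square in [u] bounds the form below by a multiple of [v ^+ 2]; doing so in [v],
    after scaling by [C], handles [u ^+ 2]. The denominator [1 + C] serves both cases of the
    maximum. *)
Lemma quad_ge {R : realType} (B C u v : R) : B ^+ 2 < 4 * C ->
  (C - B ^+ 2 / 4) / (1 + C) * Num.max `|u| `|v| ^+ 2 <= quad B C u v.
Proof.
move=> BC; have C0 : 0 < C by have := sqr_ge0 B; lra.
have k0 : 0 < C - B ^+ 2 / 4 by lra.
rewrite mulrAC ler_pdivrMr; last by rewrite addr_gt0.
have qv : quad B C u v = (u - B / 2 * v) ^+ 2 + (C - B ^+ 2 / 4) * v ^+ 2.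
  by rewrite /quad; field.
have qu : C * quad B C u v =
    (C * v - B / 2 * u) ^+ 2 + (C - B ^+ 2 / 4) * u ^+ 2.
  by rewrite /quad; field.
have q0 : (C - B ^+ 2 / 4) * v ^+ 2 <= quad B C u v.
  by rewrite qv; have := sqr_ge0 (u - B / 2 * v); lra.
have Cq0 : (C - B ^+ 2 / 4) * u ^+ 2 <= C * quad B C u v.
  by rewrite qu; have := sqr_ge0 (C * v - B / 2 * u); lra.
have kv := mulr_ge0 (ltW k0) (sqr_ge0 v).
have ku := mulr_ge0 (ltW k0) (sqr_ge0 u).
have Q0 := le_trans kv q0; have CQ0 := mulr_ge0 (ltW C0) Q0.
by case: (leP `|u| `|v|) => _; rewrite real_normK ?num_real//; lra.
Qed.

Lemma expRN_remainder {R : realType} (v : R) : `|v| <= 1 / 2 ->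
  0 <= expR (- v) - 1 + v <= 2 * v ^+ 2.
Proof.
rewrite ler_norml => /andP[v1 v2]; have := expR_ge1Dx (- v).
have ev := expR_ge1Dx v; have e0 := expR_gt0 (- v).
have ee : expR v * expR (- v) = 1 by rewrite -expRD subrr expR0.
move=> ?; apply/andP; split; first lra.
(* The upper bound comes from [(1 + v) * expR (- v) <= 1], with [1 + v >= 1 / 2]. *)
have := ler_wpM2r (ltW e0) ev; rewrite ee.
have := sqr_ge0 v; nra.
Qed.

(** Both steps have the same second coordinate, and their first coordinates differ by some [r] of
    order [s ^+ 2]. The forms then differ by [r] times a factor of order [s]. *)
Lemma quad_step_close {R : realType} (a b B C : R) : 0 <= a -> 0 <= b ->
  exists2 K, 0 < K & forall u v s : R, `|u| <= s -> `|v| <= s -> s <= 1 / 2 ->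
    `|quad B C (a * u * expR (- v) + b * (expR (- v) - 1)) u
      - quad B C (a * u - b * v) u| <= K * s ^+ 3.
Proof.
move=> a0 b0; pose k := 2 * a + 2 * b.
have k0 : 0 <= k by rewrite /k; lra.
exists (k * (2 * (a + b) + `|B| + k) + 1).
  by have B0 := normr_ge0 B; rewrite ltr_wpDl// mulr_ge0//; lra.
move=> u v s us vs s12.
have s0 := le_trans (normr_ge0 u) us.
have /andP[] := expRN_remainder _ (le_trans vs s12).
set E := expR (- v) => E0 E2.
have v2 : v ^+ 2 <= s ^+ 2.
  by rewrite -real_normK ?num_real// lerXn2r ?nnegrE.
have Er : `|E - 1 + v| <= 2 * s ^+ 2 by rewrite ger0_norm//; lra.
have E1 : `|E - 1| <= 2 * s.
  have s2 : 2 * s ^+ 2 <= s by nra.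
  rewrite -[E - 1](addrK v) (le_trans (ler_normB _ _))//.
  by lra.
pose r := a * u * (E - 1) + b * (E - 1 + v).
have r_le : `|r| <= k * s ^+ 2.
  rewrite /k mulrDl (le_trans (ler_normD _ _))// lerD// !normrM.
    rewrite (ger0_norm a0) [2 * a]mulrC -!mulrA ler_wpM2l//.
    by rewrite expr2 mulrCA ler_pM.
  by rewrite (ger0_norm b0) [2 * b]mulrC -mulrA ler_wpM2l.
have -> : quad B C (a * u * E + b * (E - 1)) u - quad B C (a * u - b * v) u
    = r * (2 * (a * u - b * v) - B * u + r).
  by rewrite /quad /r; ring.
have t_le : `|2 * (a * u - b * v) - B * u + r| <= (2 * (a + b) + `|B| + k) * s.
  rewrite [leRHS]mulrDl [(_ + `|B|) * s]mulrDl
    (le_trans (ler_normD _ _))// lerD//; last first.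
    by rewrite (le_trans r_le)// expr2 mulrA ler_piMr// ?mulr_ge0//; lra.
  rewrite (le_trans (ler_normB _ _))// lerD//; last by rewrite normrM ler_wpM2l.
  rewrite normrM ger0_norm// -mulrA ler_wpM2l// mulrDl.
  rewrite (le_trans (ler_normB _ _))// lerD// normrM ger0_norm// ler_wpM2l//.
rewrite [leRHS]mulrDl mul1r ler_wpDr ?exprn_ge0//.
rewrite (_ : k * _ * s ^+ 3 = k * s ^+ 2 * ((2 * (a + b) + `|B| + k) * s)).
  by rewrite normrM ler_pM.
by ring.
Qed.

(** The hypotheses put both roots of [x ^+ 2 - a * x + b] inside the unit disc, so the discrete
    Lyapunov equation with right-hand side a multiple of the identity has a positive definite
    solution. *)
Lemma quad_step_decrease {R : realType} (a b : R) :
    0 <= a -> 0 <= b -> a < 1 + b -> b < 1 ->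
  exists B C del : R, [/\ 0 < del, B ^+ 2 < 4 * C &
    forall u v, quad B C (a * u - b * v) u
                = quad B C u v - del * (u ^+ 2 + v ^+ 2)].
Proof.
move=> a_ge0 b_ge0 ab b1; have b0 : 0 < 1 + b by lra.
pose del := (1 - b) * ((1 + b) ^+ 2 - a ^+ 2) / (2 * (1 + b)).
have ab2 : a ^+ 2 < (1 + b) ^+ 2 by rewrite ltrXn2r ?nnegrE// ltW.
have del0 : 0 < del by rewrite divr_gt0 ?mulr_gt0//; lra.
(* [B] makes the mixed terms of [quad] before and after a linear step cancel;
   [C] then splits the remaining gain evenly between [u ^+ 2] and [v ^+ 2]. *)
exists (2 * a * b / (1 + b)), (b ^+ 2 + del), del; split => //.
- have : (2 * a * b / (1 + b)) ^+ 2 <= 4 * b ^+ 2; last lra.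
  rewrite expr_div_n ler_pdivrMr ?exprn_gt0//.
  by have := ler_wpM2l (sqr_ge0 b) (ltW ab2); lra.
- by move=> u v; rewrite /quad /del; field; lra.
Qed.

(** The form is the homogenized characteristic polynomial of the linear step. It splits over the
    eigenvalues into two linear factors, each scaled by an eigenvalue, and their product is the
    determinant [b]. *)
Lemma quad_step_increase {R : realType} (a b u v : R) :
  quad a b (a * u - b * v) u = b * quad a b u v.
Proof. by rewrite /quad; ring. Qed.

(** * Stability of the fixed point in terms of [b] *)

Section PlanarMap.
Context {R : realType} {r h y : R}.
Hypotheses (r_gt0 : 0 < r) (h_gt0 : 0 < h) (ry : r < y).
Hypothesis y_eq : equilibrium r h y.

Let a := expR (r - y).
Let b := y - h.
Let u (z : R * R) := z.1 - y.
Let v (z : R * R) := z.2 - y.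

Let a_gt0 : 0 < a. Proof. exact: expR_gt0. Qed.

Let a_lt1 : a < 1. Proof. by rewrite expR_lt1 subr_lt0. Qed.

Let bE : b = y * a. Proof. by rewrite /b {1}y_eq addrK. Qed.

Let b_gt0 : 0 < b. Proof. by rewrite bE mulr_gt0// (lt_trans r_gt0). Qed.

Let normE z : `|z - (y, y)| = Num.max `|u z| `|v z|. Proof. by []. Qed.

Lemma planar_map_nonneg z :
  nonneg_quadrant z -> nonneg_quadrant (planar_map r h z).
Proof.
by move=> [z1 z2]; split => //=; rewrite addr_ge0 ?mulr_ge0 ?expR_ge0// ltW.
Qed.

Let planar_map_u z : u (planar_map r h z)
  = a * u z * expR (- v z) + b * (expR (- v z) - 1).
Proof.
have -> : u (planar_map r h z) = z.1 * expR (r - z.2) + h - y by [].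
have -> : r - z.2 = (r - y) + - v z by rewrite /v; ring.
have -> : h = y - b by rewrite /b; ring.
rewrite expRD -/a -/b /u bE; ring.
Qed.

Let planar_map_v z : v (planar_map r h z) = u z. Proof. by []. Qed.

(** Within radius [eps / K], one power of the norm in the cubic error [K * s ^+ 3] is absorbed into
    [eps]. *)
Let quad_planar_map B C eps : 0 < eps -> exists2 eta, 0 < eta &
  forall z, `|z - (y, y)| < eta ->
    `|quad B C (u (planar_map r h z)) (v (planar_map r h z))
      - quad B C (a * u z - b * v z) (u z)| <= eps * `|z - (y, y)| ^+ 2.
Proof.
move=> eps0; have [K K0 KP] := quad_step_close a b B C (ltW a_gt0) (ltW b_gt0).
exists (Num.min (1 / 2) (eps / K)); first by rewrite lt_min !divr_gt0.
move=> z; rewrite lt_min => /andP[/ltW s12]; rewrite ltr_pdivlMr// => /ltW sK.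
rewrite planar_map_u planar_map_v (le_trans (KP _ _ _ _ _ s12))//.
- by rewrite normE le_max lexx.
- by rewrite normE le_max lexx orbT.
- by rewrite exprS mulrA [K * _]mulrC ler_wpM2r// sqr_ge0.
Qed.

Lemma planar_map_stable : b < 1 ->
  locally_asymptotically_stable (@nonneg_quadrant R) (planar_map r h) (y, y).
Proof.
move=> b1; have ab : a < 1 + b by have := a_lt1; have := b_gt0; lra.
have [B [C [del [del0 BC qdel]]]] :=
  quad_step_decrease _ _ (ltW a_gt0) (ltW b_gt0) ab b1.
(* The nonlinear error may consume half of the linear decrease. *)
have del2 : 0 < del / 2 by rewrite divr_gt0.
have [eta eta0 etaP] := quad_planar_map B C _ del2.
have C0 : 0 < C by have := sqr_ge0 B; lra.
(* The extra [del] makes the contraction factor [1 - del / 2 / M] nonnegative. *)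
pose M := 1 + `|B| + C + del.
have B0 := normr_ge0 B.
have M0 : 0 < M by rewrite /M; lra.
have QM z : quad B C (u z) (v z) <= M * `|z - (y, y)| ^+ 2.
  apply: (le_trans (quad_le _ _ _ _ `|z - (y, y)| _ _ (ltW C0))).
  - by rewrite normE le_max lexx.
  - by rewrite normE le_max lexx orbT.
  - by rewrite ler_wpM2r ?sqr_ge0// /M; lra.
apply: (lyapunov_asymptotically_stable _ _ _ _ (fun z => quad B C (u z) (v z))
  ((C - B ^+ 2 / 4) / (1 + C)) M (1 - del / 2 / M) eta) => //.
- by rewrite divr_gt0//; lra.
- apply/andP; split; last by rewrite ltrBlDr ltrDl divr_gt0.
  by rewrite subr_ge0 ler_pdivrMr// /M; lra.
- by move=> z; rewrite QM andbT normE quad_ge.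
- exact: planar_map_nonneg.
- move=> z Dz /etaP; rewrite ler_norml qdel => /andP[_ le_eps].
  have sq : `|z - (y, y)| ^+ 2 <= u z ^+ 2 + v z ^+ 2.
    rewrite normE; have := sqr_ge0 (u z); have := sqr_ge0 (v z).
    by case: (leP `|u z| `|v z|) => _; rewrite real_normK ?num_real//; lra.
  have : del / 2 / M * quad B C (u z) (v z) <= del / 2 * `|z - (y, y)| ^+ 2.
    by rewrite mulrAC ler_pdivrMr// -[leRHS]mulrA ler_pM2l// mulrC.
  have := ler_pM2l del0 (`|z - (y, y)| ^+ 2) (u z ^+ 2 + v z ^+ 2).
  by rewrite sq; lra.
Qed.

Lemma planar_map_unstable : 1 < b ->
  unstable (@nonneg_quadrant R) (planar_map r h) (y, y).
Proof.
move=> b1; have aab : a ^+ 2 < 4 * b.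
  by have := a_gt0; have := a_lt1; nra.
pose m := (b - a ^+ 2 / 4) / (1 + b).
have m0 : 0 < m by rewrite divr_gt0//; lra.
(* With this tolerance the error is at most [(b - 1) / 2] times the form, so the factor [b] drops
   only to [(1 + b) / 2]. *)
have eps0 : 0 < m * ((b - 1) / 2) by rewrite mulr_gt0// divr_gt0//; lra.
have [eta eta0 etaP] := quad_planar_map a b _ eps0.
have a0 := normr_ge0 a.
apply: (expanding_unstable _ _ _ _ (fun z => quad a b (u z) (v z))
  (1 + `|a| + b) ((1 + b) / 2) eta) => //.
- by lra.
- by lra.
- move=> z; apply: quad_le; last exact: ltW.
  + by rewrite normE le_max lexx.
  + by rewrite normE le_max lexx orbT.
- exact: planar_map_nonneg.
- move=> z Dz /etaP; rewrite ler_norml quad_step_increase => /andP[ge_eps _].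
  have : m * ((b - 1) / 2) * `|z - (y, y)| ^+ 2
      <= (b - 1) / 2 * quad a b (u z) (v z).
    by rewrite mulrAC mulrC ler_wpM2l ?normE ?quad_ge//; lra.
  by lra.
(* On the line [v = 0] the form is [u ^+ 2]; moving to the right stays in the quadrant. *)
- move=> d d0; exists (y + d / 2, y).
  have u_d : u (y + d / 2, y) = d / 2 by rewrite /u /=; ring.
  have v_0 : v (y + d / 2, y) = 0 by rewrite /v /=; ring.
  rewrite normE u_d v_0 /quad normr0; split.
  + by have := lt_trans r_gt0 ry; split => /=; lra.
  + by rewrite gt_max d0 andbT ger0_norm; lra.
  + by rewrite mulr0 expr0n/= mulr0 subr0 addr0 exprn_gt0// divr_gt0.
Qed.

End PlanarMap.

(** * Existence, uniqueness and location of the equilibrium *)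

Section Equilibrium.
Context {R : realType} {r h : R}.
Hypotheses (r_gt0 : 0 < r) (h_gt0 : 0 < h).

Let F (y : R) := y * (1 - expR (r - y)).

Let equilibriumE y : equilibrium r h y <-> F y = h.
Proof. by rewrite /equilibrium /F mulrBr mulr1; split => [{1}->|<-]; ring. Qed.

Let F_lt x y : r <= x -> x < y -> F x < F y.
Proof.
move=> rx xy; have := r_gt0.
have : expR (r - y) < expR (r - x) by rewrite ltr_expR; lra.
have : expR (r - x) <= 1 by rewrite expR_le1; lra.
rewrite /F; nra.
Qed.

Lemma equilibrium_gt y : 0 <= y -> equilibrium r h y -> r < y.
Proof.
move=> y0 /equilibriumE Fy; have h0 := h_gt0; rewrite ltNge; apply/negP => yr.
have : 1 <= expR (r - y) by rewrite -expR0 ler_expR subr_ge0.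
by move: Fy; rewrite /F; nra.
Qed.

Lemma equilibrium_unique x y : 0 <= x -> 0 <= y ->
  equilibrium r h x -> equilibrium r h y -> x = y.
Proof.
move=> x0 y0 xE yE; have rx := equilibrium_gt _ x0 xE.
have ry := equilibrium_gt _ y0 yE; move/equilibriumE : xE => Fx.
move/equilibriumE : yE => Fy; case: (ltgtP x y) => // xy.
- by have := F_lt _ _ (ltW rx) xy; rewrite Fx Fy ltxx.
- by have := F_lt _ _ (ltW ry) xy; rewrite Fx Fy ltxx.
Qed.

Lemma equilibrium_exists : exists2 y, 0 <= y & equilibrium r h y.
Proof.
have [r0 h0] := (r_gt0, h_gt0); have rt : r <= r + (h + 1) by lra.
have Fr : F r = 0 by rewrite /F subrr expR0 subrr mulr0.
(* Since [expR (h + 1) >= h + 2], the value is at least [(h + 1) ^+ 2 / (h + 2)], which is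
   [h + 1 / (h + 2)]. *)
have Ft : h <= F (r + (h + 1)).
  have := expR_ge1Dx (h + 1).
  have -> : F (r + (h + 1)) = (r + (h + 1)) * (1 - expR (- (h + 1))).
    by congr (_ * (1 - expR _)); ring.
  rewrite expRN => e1.
  have : (expR (h + 1))^-1 <= (h + 2)^-1.
    by rewrite lef_pV2 ?posrE ?expR_gt0; lra.
  have : (h + 2) * (h + 2)^-1 = 1 by rewrite mulfV//; lra.
  have : 0 < (h + 2)^-1 by rewrite invr_gt0; lra.
  set p := (h + 2)^-1; set q := (expR _)^-1 => p0 hp qp.
  have : (r + (h + 1)) * (1 - p) <= (r + (h + 1)) * (1 - q).
    by rewrite ler_wpM2l; lra.
  nra.
have cF : {within `[r, r + (h + 1)], continuous F}.
  apply: continuous_subspaceT => x; apply: cvgM; first exact: cvg_id.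
  apply: cvgB; first exact: cvg_cst.
  apply: (@continuous_comp _ _ _ (fun y : R => r - y) expR).
    by apply: cvgB; [exact: cvg_cst | exact: cvg_id].
  exact: continuous_expR.
have [|y] := IVT rt cF (v := h).
  by rewrite Fr ge_min le_max Ft (ltW h_gt0) orbT.
rewrite in_itv/= => /andP[ry _] Fy; exists y.
  by rewrite (le_trans _ ry)// ltW.
exact/equilibriumE.
Qed.

Let F_mono x y : r <= x -> r <= y -> (F x < F y) = (x < y).
Proof.
move=> rx ry; apply/idP/idP; last exact: F_lt.
by apply: contraTT; rewrite -!leNgt le_eqVlt => /predU1P[->//|/F_lt/ltW]; apply.
Qed.

Lemma equilibrium_ltE y c : r <= c -> r <= y -> equilibrium r h y ->
  (y < c) = (h < c * (1 - expR (r - c))).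
Proof. by move=> rc ry /equilibriumE <-; rewrite F_mono. Qed.

Lemma equilibrium_gtE y c : r <= c -> r <= y -> equilibrium r h y ->
  (c < y) = (c * (1 - expR (r - c)) < h).
Proof. by move=> rc ry /equilibriumE <-; rewrite F_mono. Qed.

End Equilibrium.

Theorem lemma3p2 (R : realType) (r h : R) (r_gt0 : 0 < r) (h_gt0 : 0 < h) :
  exists ybar : R,
    [/\ 0 <= ybar /\ equilibrium r h ybar,
        forall y : R, 0 <= y -> equilibrium r h y -> y = ybar,
        Num.max r h < ybar,
        r < r1 h ->
          locally_asymptotically_stable (@nonneg_quadrant R) (planar_map r h)
            (ybar, ybar)
      & r1 h < r ->
          unstable (@nonneg_quadrant R) (planar_map r h) (ybar, ybar)].
Proof.
have [y y0 yE] := equilibrium_exists r_gt0 h_gt0.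
have ry := equilibrium_gt h_gt0 _ y0 yE.
have h1 : 0 < h + 1 by rewrite addr_gt0.
(* Hence the gain at [h + 1] is [h + 1 - expR (r - r1 h)], and comparing it with [h] means comparing
   [r] with [r1 h]. *)
have rE : expR (r - (h + 1)) * (h + 1) = expR (r - r1 h).
  by rewrite -[X in _ * X]lnK ?posrE// -expRD /r1; congr expR; ring.
have ln0 : 0 < ln (h + 1) by rewrite ln_gt0// ltrDr.
exists y; split.
- by [].
- by move=> x x0 xE; apply: (equilibrium_unique r_gt0 h_gt0).
- rewrite gt_max ry andTb [ltRHS]yE ltrDr mulr_gt0 ?expR_gt0//.
  exact: lt_trans ry.
- move=> rr1; apply: planar_map_stable => //.
  rewrite ltrBlDl (equilibrium_ltE r_gt0 _ _ _ (ltW ry) yE).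
    have : expR (r - r1 h) < 1 by rewrite expR_lt1 subr_lt0.
    by rewrite -rE; lra.
  by move: rr1; rewrite /r1; lra.
- move=> r1r; apply: planar_map_unstable => //.
  (* Monotonicity of the gain is available only from [r] on; if [h + 1 <= r], then [r < y] settles
     the claim directly. *)
  rewrite ltrBrDl; have [rh|/le_lt_trans->//] := ltP r (h + 1).
  rewrite (equilibrium_gtE r_gt0 _ _ (ltW rh) (ltW ry) yE).
  have : 1 < expR (r - r1 h) by rewrite expR_gt1 subr_gt0.
  by rewrite -rE; lra.
Qed.
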